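(* Let $F\colon\mathbb{R}^m\to\mathbb{R}$ be an averaging operator and let $a_0\in C^\infty([0,\infty),\mathbb{R})$. Then there is a solution $u$ of $$u_t(x,t)-\Delta_F u(x,t)=0\quad\text{in } \mathbb{T}_m\times(0,+\infty)$$ such that $$u(\emptyset,t)=a_0(t)\quad\text{for all } t\in[0,+\infty).$$
   Context: Let $m\in\mathbb{N}$, $m>2$. $\mathbb{T}_m$ is the directed tree with regular $m$-branching: its vertices are the empty sequence $\emptyset$ (the first node, or root) and all finite sequences $(a_1,\dots,a_k)$, $k\in\mathbb{N}$, with $a_i\in\{0,1,\dots,m-1\}$. Each vertex $x$ has $m$ successors $(x,0),\dots,(x,m-1)$, obtained by appending one more coordinate to $x$. An averaging operator is a continuous function $F\colon\mathbb{R}^m\to\mathbb{R}$ such that: (i) $F(0,\dots,0)=0$ and $F(1,\dots,1)=1$; (ii) $F(tx_1,\dots,tx_m)=tF(x_1,\dots,x_m)$ for all $t\in\mathbb{R}$; (iii) $F(t+x_1,\dots,t+x_m)=t+F(x_1,\dots,x_m)$ for all $t\in\mathbb{R}$; (iv) $F(x_1,\dots,x_m)<\max\{x_1,\dots,x_m\}$ if not all $x_j$ are equal; (v) $F$ is nondecreasing with respect to each variable. $\Delta_F u(x,t)=F(u((x,0),t),\dots,u((x,m-1),t))-u(x,t)$. A solution of the equation is a function $u\colon\mathbb{T}_m\times[0,+\infty)\to\mathbb{R}$ such that, for each vertex $x$, $u(x,\cdot)$ is continuous on $[0,+\infty)$, differentiable on $(0,+\infty)$, and satisfies the equation at every $t>0$;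 no boundedness is required. *)

(* Defs.v *)
From HB Require Import structures.
From mathcomp Require Import all_boot all_order all_algebra.
From mathcomp Require Import all_classical all_reals all_analysis.

Set Implicit Arguments.
Unset Strict Implicit.
Unset Printing Implicit Defensive.

Import Order.TTheory GRing.Theory Num.Theory.
Import numFieldNormedType.Exports.

Local Open Scope classical_set_scope.
Local Open Scope ring_scope.

(* The finite sequence (a_1, ..., a_k) is the list [:: a_1; ...; a_k]; the
   root is [::]. *)
Definition vertex (m : nat) : Type := seq 'I_m.

Definition root_vertex (m : nat) : vertex m := [::].

Definition successor (m : nat) (x : vertex m) (i : 'I_m) : vertex m :=
  rcons x i.

(* The maximum in avg_lt_max is taken in \bar R, where -oo is neutral, so that
   no default value is needed. *)
Record averaging_operator (R : realType) (m : nat) (F : 'rV[R]_m -> R) : Prop :=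
  AveragingOperator {
    avg_continuous : continuous F ;
    avg0 : F (const_mx 0) = 0 ;
    avg1 : F (const_mx 1) = 1 ;
    avg_homogeneous : forall (t : R) (x : 'rV[R]_m), F (t *: x) = t * F x ;
    avg_translation : forall (t : R) (x : 'rV[R]_m),
      F (const_mx t + x) = t + F x ;
    avg_lt_max : forall x : 'rV[R]_m, ~ (forall i j, x 0 i = x 0 j) ->
      ((F x)%:E < \big[maxe/-oo]_(j < m) (x 0 j)%:E)%E ;
    avg_nondecreasing : forall (x y : 'rV[R]_m) (i : 'I_m),
      (forall j, j != i -> x 0 j = y 0 j) -> x 0 i <= y 0 i -> F x <= F y
  }.

(* A function on [0, +oo[ is represented by a total function on R of which
   only the values on [0, +oo[ are used: difference quotients are taken over
   s >= 0 only, so the derivative at 0 is the right derivative. *)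
Definition halfline_quotient (R : realType) (f : R -> R) (t s : R) : R :=
  (f s - f t) / (s - t).

Definition halfline_derivable (R : realType) (f : R -> R) (t : R) : Prop :=
  cvg (halfline_quotient f t s @[s --> within `[0, +oo[ t^']).

Definition halfline_derive (R : realType) (f : R -> R) (t : R) : R :=
  lim (halfline_quotient f t s @[s --> within `[0, +oo[ t^']).

(* C^oo([0, +oo[): derivatives of all orders exist on [0, +oo[, one-sided ones
   at 0; their continuity is then automatic. *)
Definition smooth_halfline (R : realType) (f : R -> R) : Prop :=
  forall (n : nat) (t : R), 0 <= t ->
    halfline_derivable (iter n (@halfline_derive R) f) t.

Definition tree_laplacian (R : realType) (m : nat) (F : 'rV[R]_m -> R)
    (u : vertex m -> R -> R) (x : vertex m) (t : R) : R :=
  F (\row_(i < m) u (successor x i) t) - u x t.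

(* Only the values u x t with t >= 0 matter. *)
Definition heat_solution (R : realType) (m : nat) (F : 'rV[R]_m -> R)
    (u : vertex m -> R -> R) : Prop :=
  forall x : vertex m,
    [/\ {within `[0, +oo[, continuous (u x)},
        forall t : R, 0 < t -> derivable (u x) t 1 &
        forall t : R, 0 < t -> (u x)^`()%classic t - tree_laplacian F u x t = 0].

(* Main.v *)
Require Import Defs.
From mathcomp Require Import all_boot all_order all_algebra.
From mathcomp Require Import all_classical all_reals all_analysis.
Import Order.TTheory GRing.Theory Num.Theory.
Local Open Scope ring_scope.
Import numFieldNormedType.Exports.
Local Open Scope classical_set_scope.

(** The equation prescribes only the [F]-average of the values at the
    successors of a vertex, so it can be solved from the root downwards, and
    the simplest choice is to give all successors the same value.  An averaging
    operator maps the constant vector [c] to [c] ([averaging_operator_const]);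
    hence [u x t = a_k t], depending on [x] only through its level [k], is a
    solution as soon as [a_(k+1) = a_k + a_k'].

    Starting from [a0], this recursion loses one derivative per level, which is
    harmless because [f |-> f + f'] preserves smoothness on the half-line
    ([smooth_halflineD_derive]).  It remains to see that half-line
    differentiability gives continuity on [0, +oo[, including the end point
    ([halfline_derivable_continuous]), and that at interior points it is
    ordinary differentiability ([halfline_derivable_is_derive]). *)

Section HalflineDerivative.
Context {R : realType}.
Implicit Types (f g : R -> R) (t l : R).

(** This is what makes half-line derivatives unique, including at the end point
    [t = 0]; the points witnessing it lie to the right of [t]. *)
Lemma halfline_dnbhs_proper t : 0 <= t -> ProperFilter (within `[0, +oo[ t^').
Proof.
move=> t0; split; last exact: within_filter.
move=> /nbhs_ballP[e /= e0 H].
have e2 : 0 < e / 2 by rewrite divr_gt0.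
apply: (H (t + e / 2)).
- rewrite /ball /= opprD addrA subrr sub0r normrN gtr0_norm//.
  by rewrite ltr_pdivrMr// mulr_natr mulr2n ltrDl.
- by rewrite gt_eqF// ltrDl.
- by rewrite /= in_itv/= andbT addr_ge0// ltW.
Qed.

Definition has_halfline_derive f t l : Prop :=
  halfline_quotient f t s @[s --> within `[0, +oo[ t^'] --> l.

Lemma halfline_deriveP f t :
  halfline_derivable f t -> has_halfline_derive f t (halfline_derive f t).
Proof. by []. Qed.

Lemma has_halfline_derive_unique f t l :
  0 <= t -> has_halfline_derive f t l -> halfline_derive f t = l.
Proof.
by move=> t0 fl; have P := halfline_dnbhs_proper _ t0;
  exact: (cvg_lim (@norm_hausdorff _ R^o) fl).
Qed.

Lemma has_halfline_derive_derivable f t l :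
  has_halfline_derive f t l -> halfline_derivable f t.
Proof. by move=> fl; apply/cvg_ex; exists l. Qed.

(** Equality is required on the half-line only, because smoothness says nothing
    about the values of [halfline_derive] at negative arguments, so that
    identities between derivatives cannot be expected there. *)
Lemma eq_has_halfline_derive f g t l : 0 <= t ->
  (forall s, 0 <= s -> f s = g s) ->
  has_halfline_derive f t l -> has_halfline_derive g t l.
Proof.
move=> t0 fg; apply: cvg_trans; apply: near_eq_cvg.
rewrite near_withinE; apply: filterE => s; rewrite /= in_itv/= andbT => s0.
by rewrite /halfline_quotient !fg.
Qed.

Lemma has_halfline_deriveD f g t k l :
  has_halfline_derive f t k -> has_halfline_derive g t l ->
  has_halfline_derive (f \+ g) t (k + l).
Proof.
move=> fk gl; apply: cvg_trans (cvgD fk gl); apply: near_eq_cvg.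
apply: filterE => s.
by rewrite /halfline_quotient /= -mulrDl opprD addrACA.
Qed.

(** Differentiation commutes with [f |-> f + f'], but each step needs the
    previous identity on all of [0, +oo[, not just at [t]. *)
Lemma iter_halfline_deriveD f n t : smooth_halfline f -> 0 <= t ->
  iter n (@halfline_derive R) (f \+ halfline_derive f) t =
  iter n (@halfline_derive R) f t + iter n.+1 (@halfline_derive R) f t.
Proof.
move=> sf; elim: n t => [//|n IHn] t t0.
rewrite iterS; apply: has_halfline_derive_unique => //.
apply: (eq_has_halfline_derive _ _ _ _ t0 (fun s s0 => esym (IHn s s0))).
apply: has_halfline_deriveD; apply: halfline_deriveP.
  exact: (sf n).
exact: (sf n.+1).
Qed.

Lemma smooth_halflineD_derive f :
  smooth_halfline f -> smooth_halfline (f \+ halfline_derive f).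
Proof.
move=> sf n t t0.
apply: (@has_halfline_derive_derivable _ _
  (iter n.+1 (@halfline_derive R) f t + iter n.+2 (@halfline_derive R) f t)).
apply: (eq_has_halfline_derive _ _ _ _ t0
  (fun s s0 => esym (iter_halfline_deriveD f n s sf s0))).
apply: has_halfline_deriveD; apply: halfline_deriveP.
  exact: (sf n).
exact: (sf n.+1).
Qed.

(** As usual, [f s = f t + (s - t) * q s] for [s != t], where the difference
    quotient [q] has a limit at [t]. *)
Lemma halfline_derivable_continuous f :
  (forall t, 0 <= t -> halfline_derivable f t) ->
  {within `[0, +oo[, continuous f}.
Proof.
move=> df; apply/subspace_continuousP => t; rewrite /= in_itv/= andbT => t0.
have st : (s - t) @[s --> within `[0, +oo[ t^'] --> (0 : R).
  have st : (s - t) @[s --> t] --> (0 : R).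
    by rewrite -[X in _ --> X](subrr t); apply: cvgB cvg_id (cvg_cst _).
  by apply: cvg_trans st => V /= /nbhs_dnbhs; exact: cvg_within.
have ft : f t + (s - t) * halfline_quotient f t s
    @[s --> within `[0, +oo[ t^'] --> f t.
  rewrite -[X in _ --> X]addr0 -[X in f t + X](mul0r (halfline_derive f t)).
  apply: cvgD; first exact: cvg_cst.
  exact: cvgM st (halfline_deriveP _ _ (df t t0)).
move=> V fV.
have : \forall s \near t, s != t -> `[0, +oo[ s ->
    V (f t + (s - t) * halfline_quotient f t s) by exact: (ft V fV).
suff fE (s : R) : (s != t -> `[0, +oo[ s ->
    V (f t + (s - t) * halfline_quotient f t s)) -> `[0, +oo[ s -> V (f s).
  exact: filterS.
(* The limit only concerns [s != t]; at [s = t] there is nothing to prove. *)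
move=> Vs s0; have [->|ts] := eqVneq s t; first exact: nbhs_singleton.
move: (Vs ts s0); rewrite /halfline_quotient mulrC divfK ?subr_eq0//.
by rewrite addrC subrK.
Qed.

(** The increment [h] of the usual difference quotient corresponds to the point
    [s = h + t] of the half-line one, so this is a change of variable in the
    limit. *)
Lemma halfline_derivable_is_derive f t :
  0 < t -> halfline_derivable f t -> is_derive t 1 f (halfline_derive f t).
Proof.
move=> t0 df.
(* Near an interior point the constraint [0 <= s] is void. *)
have shift_t : (h + t) @[h --> 0^'] --> within `[0, +oo[ t^'.
  move=> V /= tV.
  have ht : (h + t) @[h --> 0] --> (0 : R) + t.
    by apply: cvgD cvg_id (cvg_cst _).
  rewrite add0r in ht.
  have Vt : \forall h \near (0 : R),
      h + t != t -> `[0, +oo[ (h + t) -> V (h + t) by exact: (ht _ tV).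
  have ht0 : \forall h \near (0 : R), 0 < h + t.
    by apply: (ht (fun s => 0 < s)); exact: lt_nbhsr.
  rewrite /nbhs/= /dnbhs/within/=; near=> h => h0.
  have h_gt : 0 < h + t by near: h.
  have Vh : h + t != t -> `[0, +oo[ (h + t) -> V (h + t) by near: h.
  apply: Vh; first by rewrite -subr_eq0 addrK.
  by rewrite /= in_itv/= andbT ltW.
have fl : h^-1 *: ((f \o shift t) (h *: (1 : R)) - f t) @[h --> 0^'] -->
          halfline_derive f t.
  apply: cvg_trans (cvg_comp _ _ shift_t (halfline_deriveP _ _ df)).
  apply: near_eq_cvg; apply: filterE => h /=.
  by rewrite /halfline_quotient addrK mulrC /GRing.scale/= mulr1.
split; first by apply/cvg_ex; exists (halfline_derive f t).
exact: (cvg_lim (@norm_hausdorff _ R^o) fl).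
Unshelve. all: by end_near.
Qed.
End HalflineDerivative.

(** Translate the zero vector by [c]. *)
Lemma averaging_operator_const (R : realType) (m : nat) (F : 'rV[R]_m -> R) c :
  averaging_operator F -> F (const_mx c) = c.
Proof.
move=> hF; by rewrite -[const_mx c]addr0 (avg_translation hF) (avg0 hF) addr0.
Qed.

Theorem theorem1p5 (R : realType) (m : nat) (hm : (2 < m)%N)
    (F : 'rV[R]_m -> R) (hF : averaging_operator F)
    (a0 : R -> R) (ha0 : smooth_halfline a0) :
  exists u : vertex m -> R -> R,
    heat_solution F u /\
    (forall t : R, 0 <= t -> u (root_vertex m) t = a0 t).
Proof.
pose a k := iter k (fun g : R -> R => g \+ halfline_derive g) a0.
have sa k : smooth_halfline (a k).
  by elim: k => [//|k IHk]; exact: smooth_halflineD_derive.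
exists (fun x => a (size x)); split=> // x; split.
- exact: halfline_derivable_continuous (sa _ 0%N).
- move=> t t0.
  by case: (halfline_derivable_is_derive _ _ t0 (sa (size x) 0%N _ (ltW t0))).
- move=> t t0.
  have [_ dE] := halfline_derivable_is_derive _ _ t0 (sa (size x) 0%N _ (ltW t0)).
  rewrite derive1E dE /tree_laplacian.
  have -> : \row_(i < m) a (size (successor x i)) t =
            const_mx (a (size x).+1 t).
    by apply/rowP => i; rewrite !mxE size_rcons.
  by rewrite averaging_operator_const// /a /= addrAC subrr add0r subrr.
Qed.
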